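(* Let $H\in(0,1)$, $\alpha>0$, let $S_H$ be a sub-fractional Brownian motion with index $H$, and let $S_H^{\mathrm{LT}}(t)=e^{-\alpha H t}S_H(e^{\alpha t})$ for $t\in\mathbb{R}$. Then $S_H^{\mathrm{LT}}=\{S_H^{\mathrm{LT}}(t)\}_{t\in\mathbb{R}}$ is a centred stationary Gaussian process.
   Context: A sub-fractional Brownian motion $S_H=\{S_H(t)\}_{t\ge 0}$ with index $H\in(0,1)$ is a centred Gaussian process with covariance $$\mathbb{E}[S_H(s)S_H(t)]=s^{2H}+t^{2H}-\tfrac12\bigl((s+t)^{2H}+|t-s|^{2H}\bigr),\qquad s,t\ge0.$$ Stationary means that all finite-dimensional distributions are invariant under time shifts. *)

(* Defs.v *)
From HB Require Import structures.
From mathcomp Require Import all_boot all_order all_algebra.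
From mathcomp Require Import all_classical all_reals all_analysis.

Set Implicit Arguments.
Unset Strict Implicit.
Unset Printing Implicit Defensive.

Import Order.TTheory GRing.Theory Num.Theory.
Import numFieldNormedType.Exports.

Local Open Scope classical_set_scope.
Local Open Scope ring_scope.

Section processes.
Context {d : measure_display} {T : measurableType d} {R : realType}.
Variable P : probability T R.

(* Point masses count as Gaussian (variance 0). They need a separate case:
   [normal_prob m 0] is the library's junk value (uniform on [0, 1]), not
   [\d_m]. Laws are compared on measurable sets only, because [distribution]
   and [normal_prob] are set functions defined on all sets. *)
Definition gaussian_rv (X : {RV P >-> R}) : Prop :=
  (exists m : R, forall A : set R, measurable A ->
     distribution P X A = \d_m A) \/
  (exists m s : R, 0 < s /\ forall A : set R, measurable A ->
     distribution P X A = normal_prob m s A).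

Definition gaussian_process {I : Type} (X : I -> {RV P >-> R}) : Prop :=
  forall (n : nat) (t : 'I_n -> I) (a : 'I_n -> R),
    gaussian_rv (\sum_(i < n) a i *: X (t i)).

Definition centred {I : Type} (X : I -> {RV P >-> R}) : Prop :=
  forall t : I, ('E_P[X t] = 0)%E.

Definition fd_vector {I : Type} (X : I -> {RV P >-> R}) (n : nat)
    (t : 'I_n -> I) : T -> n.-tuple R :=
  fun w => [tuple X (t i) w | i < n].

Lemma measurable_fd_vector {I : Type} (X : I -> {RV P >-> R}) (n : nat)
  (t : 'I_n -> I) : measurable_fun [set: T] (fd_vector X t).
Proof.
apply/measurable_fun_tnthP => i.
rewrite (_ : _ \o _ = X (t i)); first exact: measurable_funP.
by apply/funext => w; rewrite /= tnth_mktuple.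
Qed.

HB.instance Definition _ {I : Type} (X : I -> {RV P >-> R}) (n : nat)
  (t : 'I_n -> I) := isMeasurableFun.Build _ _ _ _ (fd_vector X t)
    (measurable_fd_vector X t).

Definition stationary (X : R -> {RV P >-> R}) : Prop :=
  forall (n : nat) (t : 'I_n -> R) (h : R) (A : set (n.-tuple R)),
    measurable A ->
    distribution P (fd_vector X (fun i => t i + h)) A =
    distribution P (fd_vector X t) A.

Record sub_fBm (H : R) (S : {nonneg R} -> {RV P >-> R}) : Prop := {
  sub_fBm_gaussian : gaussian_process S ;
  sub_fBm_centred : centred S ;
  sub_fBm_covariance : forall s t : {nonneg R},
    'E_P[S s \* S t]%E =
    (s%:num `^ (2 * H) + t%:num `^ (2 * H)
     - 2^-1 * ((s%:num + t%:num) `^ (2 * H)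
               + `|t%:num - s%:num| `^ (2 * H)))%:E
}.

Definition lamperti (alpha H : R) (S : {nonneg R} -> {RV P >-> R}) :
    R -> {RV P >-> R} :=
  fun t => expR (- (alpha * H * t)) *: S (NngNum (expR_ge0 (alpha * t))).

End processes.

(* Main.v *)
Require Import Defs.
From mathcomp Require Import all_boot all_order all_algebra.
From mathcomp Require Import all_classical all_reals all_analysis.
From mathcomp Require Import measurable_realfun ring lra.

(**
The Lamperti transform is a Gaussian process whose covariance is invariant
under time shifts, because the factor [exp (- alpha H h)] exactly compensates
the [2H]-homogeneity of the sub-fractional covariance. So every linear
combination of the values of the process and of its shifted copy are centred
Gaussian with the same variance, hence have the same law, and the
finite-dimensional laws have the same characteristic functions.

That characteristic functions determine laws on [R^n] is proved without
Fourier inversion: the smallest class of functions that contains all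
[x |-> cos (a . x + c)] and is closed under linear combinations and bounded
pointwise limits is an algebra, so the sets whose indicator it contains form a
sigma-algebra. The class contains the indicator of [x_k < b], as the limit for
[m -> oo] of the indicators of [sin ((x_k - b) / m) < 0], each of which is a
limit of polynomials in that sine.
*)

Set Implicit Arguments.
Unset Strict Implicit.
Unset Printing Implicit Defensive.

Import Order.TTheory GRing.Theory Num.Theory.
Import numFieldNormedType.Exports.

Local Open Scope classical_set_scope.
Local Open Scope ring_scope.

(** * Characteristic functions determine laws *)

Section limits.
Context {R : realType}.

Lemma cvg_natr_mul_expr (r : R) : 0 <= r < 1 ->
  n%:R * r ^+ n @[n --> \oo] --> 0.
Proof.
move=> /andP[r0 r1].
have [q [q0 q1 rq]] : exists q : R, [/\ 0 < q, q < 1 & r <= q ^+ 2].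
  (* The square of the midpoint exceeds [r] by [((1 - r) / 2) ^+ 2]. *)
  by exists ((1 + r) / 2); split; nra.
(* [n q^n (1 - q) <= 1 - q^n], and [r^n <= q^n q^n]. *)
have nq n : n%:R * q ^+ n <= (1 - q)^-1.
  rewrite -[leRHS]mul1r ler_pdivlMr ?subr_gt0//.
  apply: (@le_trans _ _ (1 - q ^+ n)); last first.
    by rewrite gerBl exprn_ge0// ltW.
  elim: n => [|n IH]; first by rewrite !mul0r expr0 subrr.
  have qn0 : 0 <= q ^+ n by rewrite exprn_ge0// ltW.
  have qn1 : q ^+ n <= 1 by rewrite exprn_ile1// ltW.
  rewrite exprS -natr1.
  set a := q ^+ n in qn0 qn1 IH *; set m := n%:R in IH *.
  (* The inductive step is the sum of [h1], the induction hypothesis times [q], and [h2]. *)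
  have h1 : 0 <= (1 - a - m * (a * (1 - q))) * q.
    by apply: mulr_ge0 (ltW q0); rewrite subr_ge0 mulrA.
  have h2 : 0 <= (1 - q) * (1 - q * a).
    by rewrite mulr_ge0 ?subr_ge0 ?mulr_ile1// ltW.
  nra.
apply: (@squeeze_cvgr _ _ _ _ (cst 0) (fun n => (1 - q)^-1 * q ^+ n)).
- apply: nearW => n; rewrite mulr_ge0 ?exprn_ge0//=.
  apply: (@le_trans _ _ (n%:R * q ^+ n * q ^+ n)).
    rewrite -mulrA ler_wpM2l// -exprD addnn -mul2n exprM lerXn2r ?nnegrE//.
    by rewrite exprn_ge0// ltW.
  by rewrite ler_wpM2r// exprn_ge0// ltW.
- exact: cvg_cst.
- have := @cvg_geometric R ((1 - q)^-1) q.
  by rewrite ger0_norm ?ltW//; apply.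
Qed.

Lemma bernoulli_ge (x : R) n : 0 <= x <= 1 -> 1 - n%:R * x <= (1 - x) ^+ n.
Proof.
move=> /andP[x0 x1]; elim: n => [|n IH]; first by rewrite mul0r expr0 subr0.
rewrite exprS -natr1.
have n0 : 0 <= n%:R :> R by [].
have : (1 - x) * (1 - n%:R * x) <= (1 - x) * (1 - x) ^+ n.
  by rewrite ler_wpM2l// subr_ge0.
set m := n%:R in n0 *; set y := (1 - x) ^+ n; nra.
Qed.

(** The product [(1 - x) ^+ n * (1 + n%:R * x)] starts at 1 and does not increase with [n], because
    [(1 - x) * (1 + (n + 1) * x) = 1 + n * x - (n + 1) * x ^+ 2]. *)
Lemma bernoulli_le (x : R) n : 0 <= x <= 1 ->
  (1 - x) ^+ n <= (1 + n%:R * x)^-1.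
Proof.
move=> /andP[x0 x1]; rewrite -div1r ler_pdivlMr; last first.
  by rewrite ltr_pwDl// mulr_ge0.
elim: n => [|n IH]; first by rewrite mul0r expr0 addr0 mulr1.
rewrite exprS -natr1 (le_trans _ IH)// -mulrA mulrCA.
rewrite ler_wpM2l ?exprn_ge0 ?subr_ge0//.
have n0 : 0 <= n%:R :> R by [].
set m := n%:R in n0 *.
have : 0 <= (m + 1) * x ^+ 2 by rewrite mulr_ge0 ?sqr_ge0// addr_ge0.
nra.
Qed.

(* The exponent [n * 2 ^ n] rather than [2 ^ n] makes the threshold value
   [x = 1 / 2] go to [0]. *)
Lemma cvg_threshold (x : R) : 0 <= x <= 1 ->
  (1 - x ^+ n) ^+ (n * 2 ^ n) @[n --> \oo] --> ((x < 2^-1)%R%:R : R).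
Proof.
move=> /andP[x0 x1].
have xn n : 0 <= x ^+ n <= 1 by rewrite exprn_ge0// exprn_ile1.
(* This is the quantity in both Bernoulli bounds: it tends to 0 when [x < 2^-1] and is at least [n]
   otherwise. *)
have E n : (n * 2 ^ n)%N%:R * x ^+ n = n%:R * (2 * x) ^+ n.
  by rewrite natrM natrX exprMn mulrA.
case: (ltP x 2^-1) => h /=.
- apply: (@squeeze_cvgr _ _ _ _ (fun n => 1 - n%:R * (2 * x) ^+ n) (cst 1)).
  + apply: nearW => n; rewrite -E bernoulli_ge//=.
    by rewrite exprn_ile1 ?subr_ge0 ?gerBl//; case/andP: (xn n).
  + rewrite -[X in _ --> X]subr0; apply: cvgB; first exact: cvg_cst.
    by apply: cvg_natr_mul_expr; lra.
  + exact: cvg_cst.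
- apply: (@squeeze_cvgr _ _ _ _ (cst 0) (fun n => n.+1%:R^-1)).
  + apply: nearW => n; rewrite exprn_ge0/= ?subr_ge0; last by case/andP: (xn n).
    rewrite (le_trans (bernoulli_le _ (xn n)))// E -(nat1r n).
    rewrite lef_pV2 ?posrE ?ltr_pwDl ?mulr_ge0 ?exprn_ge0// ?mulr_ge0//.
    rewrite lerD2l ler_peMr// exprn_ege1//; lra.
  + exact: cvg_cst.
  + exact: cvg_harmonic.
Qed.

(** Once [x / m.+1] lies in [(-pi, pi)], its sine has the sign of [x], so the sequence is eventually
    constant. *)
Lemma cvg_sin_threshold (x : R) :
  ((sin (x / m.+1%:R) < 0)%R%:R : R) @[m --> \oo] --> ((x < 0)%R%:R : R).
Proof.
apply: cvg_near_cst.
have cx : `|x| * harmonic m @[m --> \oo] --> (0 : R).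
  by rewrite -(mulr0 `|x|); apply: cvgMl_tmp; exact: cvg_harmonic.
have : \forall m \near \oo, `|x| * harmonic m < pi.
  exact: cvgr_lt cx _ (pi_gt0 R).
apply: filterS => m /= hm.
have m0 : (0 : R) < m.+1%:R^-1 by rewrite invr_gt0.
case: (ltrgt0P x) hm => [x0|x0|->] hm.
- by rewrite ltNge ltW// sin_gt0_pi// mulr_gt0.
- by rewrite -oppr_gt0 -sinN -mulNr sin_gt0_pi// hm andbT mulr_gt0// oppr_gt0.
- by rewrite mul0r sin0 ltxx.
Qed.

End limits.

(** * The bounded closure of the trigonometric functions, up to indicators of Borel sets *)

Section trig_closure.
Context {R : realType} {n : nat}.
Implicit Types (f g : n.-tuple R -> R) (A : set (n.-tuple R)).

(** The phase [c] keeps everything real-valued: sines are cosines shifted by [pi / 2]. The uniform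
    bound in [trig_lim] is what dominated convergence will use. *)
Inductive trig_closure : (n.-tuple R -> R) -> Prop :=
| trig_cos (a : 'I_n -> R) (c : R) :
    trig_closure (fun x => cos (\sum_(i < n) a i * tnth x i + c))
| trig_lin (k : R) f g : trig_closure f -> trig_closure g ->
    trig_closure (fun x => k * f x + g x)
| trig_lim (f_ : nat -> n.-tuple R -> R) f (B : R) :
    (forall k, trig_closure (f_ k)) -> (forall k x, `|f_ k x| <= B) ->
    (forall x, f_ k x @[k --> \oo] --> f x) -> trig_closure f.

Lemma eq_trig_closure f g : f =1 g -> trig_closure f -> trig_closure g.
Proof. by move=> /funext ->. Qed.

Lemma trig_closure_bounded f :
  trig_closure f -> exists B, forall x, `|f x| <= B.
Proof.
elim=> [a c|k {}f g _ [B fB] _ [C gC]|f_ {}f B _ _ fB fc].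
- by exists 1 => x; exact: cos_max.
- exists (`|k| * B + C) => x; rewrite (le_trans (ler_normD _ _))//.
  by rewrite lerD// normrM ler_wpM2l.
- exists B => x; have /cvg_norm fcx := fc x.
  rewrite -(cvg_lim _ fcx)//; apply: limr_le.
    by apply/cvg_ex; eexists; exact: fcx.
  exact: nearW.
Qed.

Lemma trig_closure_measurable f :
  trig_closure f -> measurable_fun [set: n.-tuple R] f.
Proof.
elim=> [a c|k {}f g _ mf _ mg|f_ {}f B _ mf _ fc].
- apply: (measurableT_comp (f := @cos R)).
    by apply: continuous_measurable_fun; exact: continuous_cos.
  apply: measurable_funD => //; apply: measurable_sum => i.
  by apply: measurable_funM => //; exact: measurable_tnth.
- by apply: measurable_funD => //; exact: measurable_funM.
- exact: (measurable_fun_cvg mf (fun x _ => fc x)).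
Qed.

Lemma trig_closure_cst c : trig_closure (fun=> c).
Proof.
have t1 := trig_cos (fun=> 0) 0.
(* [trig_lin] always adds a second function, so the zero function is built first, as
   [- cos 0 + cos 0]. *)
have t0 := trig_lin (-1) t1 t1.
rewrite (_ : (fun=> c) = fun x => c * cos (\sum_(i < n) 0 * tnth x i + 0) +
    (-1 * cos (\sum_(i < n) 0 * tnth x i + 0) +
      cos (\sum_(i < n) 0 * tnth x i + 0))).
  exact: trig_lin.
apply/funext => x; rewrite big1 ?addr0 ?cos0; first by ring.
by move=> i _; rewrite mul0r.
Qed.

Lemma trig_closureZ k f : trig_closure f -> trig_closure (fun x => k * f x).
Proof.
move=> tf; have := trig_lin k tf (trig_closure_cst 0).
by under eq_fun do rewrite addr0.
Qed.

Lemma trig_closureD f g :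
  trig_closure f -> trig_closure g -> trig_closure (fun x => f x + g x).
Proof.
by move=> tf tg; have := trig_lin 1 tf tg; under eq_fun do rewrite mul1r.
Qed.

(** Induction on [f], and on [g] when [f] is a cosine. Two cosines are handled by [cos u * cos v =
    (cos (u + v) + cos (u - v)) / 2]; a limit in one factor passes to the product because the other
    factor is bounded. *)
Lemma trig_closureM f g :
  trig_closure f -> trig_closure g -> trig_closure (fun x => f x * g x).
Proof.
move=> tf tg; elim: tf => [a c|k {}f h _ IHf _ IHh|f_ {}f B _ IH fB fc].
- elim: tg => [b e|k {}f h _ IHf _ IHh|f_ {}f B _ IH fB fc].
  + have t1 := trig_cos (fun i => a i + b i) (c + e).
    have t2 := trig_cos (fun i => a i - b i) (c - e).
    have := trig_closureZ 2^-1 (trig_closureD t1 t2).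
    apply: eq_trig_closure => x.
    set u := \sum_(i < n) a i * tnth x i; set v := \sum_(i < n) b i * tnth x i.
    have -> : \sum_(i < n) (a i + b i) * tnth x i + (c + e) = (u + c) + (v + e).
      rewrite addrACA /u /v -big_split/=; congr (_ + _).
      by apply: eq_bigr => i _; rewrite mulrDl.
    have -> : \sum_(i < n) (a i - b i) * tnth x i + (c - e) = (u + c) - (v + e).
      rewrite opprD addrACA /u /v -sumrB; congr (_ + _).
      by apply: eq_bigr => i _; rewrite mulrBl.
    by rewrite cosD cosB; field.
  + have := trig_lin k IHf IHh.
    by under eq_fun do rewrite mulrCA -mulrDr.
  + apply: (trig_lim (B := B) IH) => [k x|x].
      by rewrite normrM -[leRHS]mul1r ler_pM// cos_max.
    by apply: cvgMl_tmp; exact: fc.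
- have := trig_lin k IHf IHh.
  by under eq_fun do rewrite mulrA -mulrDl.
- have [C gC] := trig_closure_bounded tg.
  apply: (trig_lim (B := B * C) IH) => [k x|x].
    by rewrite normrM ler_pM.
  by apply: cvgMr_tmp; exact: fc.
Qed.

Lemma trig_closureX f k : trig_closure f -> trig_closure (fun x => f x ^+ k).
Proof.
move=> tf; elim: k => [|k IH].
  by under eq_fun do rewrite expr0; exact: trig_closure_cst.
by under eq_fun do rewrite exprS; exact: trig_closureM.
Qed.

Lemma trig_closureB f g :
  trig_closure f -> trig_closure g -> trig_closure (fun x => f x - g x).
Proof.
move=> tf tg; have := trig_lin (-1) tg tf.
by under eq_fun do rewrite mulN1r addrC.
Qed.

Lemma trig_closure_threshold f : (forall x, 0 <= f x <= 1) ->
  trig_closure f -> trig_closure (fun x => (f x < 2^-1)%R%:R).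
Proof.
move=> f01 tf.
apply: (trig_lim (f_ := fun k x => (1 - f x ^+ k) ^+ (k * 2 ^ k)) (B := 1)).
- move=> k; apply: trig_closureX; apply: trig_closureB.
    exact: trig_closure_cst.
  exact: trig_closureX.
- move=> k x; have /andP[f0 f1] := f01 x.
  have h0 : 0 <= 1 - f x ^+ k by rewrite subr_ge0 exprn_ile1.
  by rewrite ger0_norm ?exprn_ge0// exprn_ile1// gerBl exprn_ge0.
- by move=> x; exact: cvg_threshold.
Qed.

Lemma trig_closure_ray (k : 'I_n) (b : R) :
  trig_closure (fun x => (tnth x k < b)%R%:R).
Proof.
apply: (trig_lim (B := 1)
    (f_ := fun m x => (sin ((tnth x k - b) / m.+1%:R) < 0)%R%:R)).
- move=> m.
  (* The coefficients select coordinate [k], and the phase [- pi / 2] turns the cosine into a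
     sine. *)
  have := trig_cos (fun i => (i == k)%:R / m.+1%:R) (- (b / m.+1%:R) - pi / 2).
  rewrite (_ : (fun x : n.-tuple R => _) =
      fun x => sin ((tnth x k - b) / m.+1%:R)); last first.
    apply/funext => x; rewrite addrA cosBpihalf; congr sin.
    rewrite (bigD1 k)//= eqxx big1 ?addr0.
      by rewrite mul1r [RHS]mulrBl [_^-1 * _]mulrC.
    by move=> i /negPf ->; rewrite !mul0r.
  move=> ts.
  (* The map [s |-> (1 + s) / 2] sends [[-1, 1]] to [[0, 1]] and the condition [s < 0] to the
     threshold [2^-1]. *)
  have t := trig_closureZ 2^-1 (trig_closureD (trig_closure_cst 1) ts).
  have := trig_closure_threshold _ t.
  rewrite (_ : (fun x => (2^-1 * _ < 2^-1)%R%:R) =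
      fun x => (sin ((tnth x k - b) / m.+1%:R) < 0)%R%:R); last first.
    apply/funext => x; congr (_%:R); congr nat_of_bool; apply/idP/idP; lra.
  apply=> x; have := sin_geN1 ((tnth x k - b) / m.+1%:R).
  have := sin_le1 ((tnth x k - b) / m.+1%:R); set s := sin _; lra.
- by move=> m x; case: (_ < _); rewrite ?normr1 ?normr0.
- by move=> x; rewrite -subr_lt0; exact: cvg_sin_threshold.
Qed.

Lemma trig_closure_sigma_algebra :
  sigma_algebra setT [set A | trig_closure (\1_A)].
Proof.
split => /=.
- by rewrite indic0; exact: trig_closure_cst.
- move=> A tA; have := trig_closureB (trig_closure_cst 1) tA.
  apply: eq_trig_closure => x; rewrite !indicE setTD in_setC.
  by case: (x \in A); rewrite ?subrr ?subr0.
- move=> F tF.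
  (* The approximants are the indicators of the finite unions, written through complements so that
     only products and differences occur. At each point they are eventually constant. *)
  apply: (trig_lim (B := 1)
      (f_ := fun k x => 1 - \prod_(i < k) (1 - \1_(F i) x))).
  + move=> k; apply: trig_closureB; first exact: trig_closure_cst.
    elim: k => [|k IH].
      by under eq_fun do rewrite big_ord0; exact: trig_closure_cst.
    under eq_fun do rewrite big_ord_recr/=; apply: trig_closureM => //.
    by apply: trig_closureB; [exact: trig_closure_cst|exact: tF].
  + move=> k x.
    have /andP[p0 p1] : 0 <= \prod_(i < k) (1 - \1_(F i) x : R) <= 1.
      elim: k => [|k IH]; first by rewrite big_ord0 ler01 lexx.
      rewrite big_ord_recr/= indicE.
      by case: (x \in F k); rewrite ?subrr ?mulr0 ?lexx ?ler01// subr0 mulr1.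
    by rewrite ger0_norm ?subr_ge0// gerBl.
  + move=> x; apply: cvg_near_cst; rewrite indicE.
    have [/set_mem[i _ Fix]|nFx] := boolP (x \in \bigcup_k F k).
    * exists i.+1 => // k /= ik.
      by rewrite (bigD1 (Ordinal ik))//= indicE mem_set// subrr mul0r subr0.
    * apply: nearW => k; rewrite big1 ?subrr// => i _.
      rewrite indicE memNset ?subr0// => Fix.
      by move/negP : nFx; apply; apply/mem_set; exists i.
Qed.

(** The sigma-algebra on tuples is generated by preimages under the coordinates. For a fixed
    coordinate, the sets [B] whose preimage is admissible form a sigma-algebra on [R] containing the
    rays, hence all Borel sets. *)
Lemma trig_closure_indic A : measurable A -> trig_closure (\1_A).
Proof.
have sA := trig_closure_sigma_algebra.
move: A; apply: smallest_sub => //.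
rewrite -bigcup_seq => _ [k _ [B mB <-]] /=; rewrite setTI.
have sB : sigma_algebra setT
    [set B : set R | trig_closure (\1_((@tnth n R ^~ k) @^-1` B))].
  case: sA => /= s0 sC sU; split => /=.
  - by rewrite preimage_set0.
  - by move=> C tC; have := sC _ tC; rewrite !setTD preimage_setC.
  - by move=> F tF; rewrite preimage_bigcup; exact: sU.
move: B mB; have -> : @measurable _ R = (@RGenInftyO.G R).-sigma.-measurable.
  exact: RGenInftyO.measurableE.
apply: smallest_sub => //.
move=> _ [b ->] /=; have := trig_closure_ray k b.
apply: eq_trig_closure => x; rewrite indicE.
congr (nat_of_bool _)%:R; apply/idP/idP => [h|/set_mem/=].
  by apply/mem_set; rewrite /= in_itv.
by rewrite in_itv.
Qed.

End trig_closure.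

(** * Equality of measures from equality of cosine integrals *)

Section uniqueness.
Context {R : realType} {n : nat}.

Lemma trig_closure_integrable (mu : probability (n.-tuple R) R) f :
  trig_closure f -> mu.-integrable setT (EFin \o f).
Proof.
move=> tf; apply: measurable_bounded_integrable => //.
- by rewrite (le_lt_trans (probability_le1 _ _))// ltry.
- exact: trig_closure_measurable.
- have [B fB] := trig_closure_bounded tf.
  exists B; split; first exact: num_real.
  by move=> x Bx y _ /=; rewrite (le_trans (fB y))// ltW.
Qed.

Variables mu nu : probability (n.-tuple R) R.
Hypothesis mu_nu : forall (a : 'I_n -> R) (c : R),
  (\int[mu]_x (cos (\sum_(i < n) a i * tnth x i + c))%:E =
   \int[nu]_x (cos (\sum_(i < n) a i * tnth x i + c))%:E)%E.

Lemma trig_closure_integral f : trig_closure f ->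
  (\int[mu]_x (f x)%:E = \int[nu]_x (f x)%:E)%E.
Proof.
elim=> [a c|k {}f g tf IHf tg IHg|f_ {}f B tf IH fB fc].
- exact: mu_nu.
- under eq_integral do rewrite EFinD EFinM.
  under [RHS]eq_integral do rewrite EFinD EFinM.
  have E (m : probability (n.-tuple R) R) :
      (\int[m]_x (k%:E * (f x)%:E + (g x)%:E) =
      k%:E * \int[m]_x (f x)%:E + \int[m]_x (g x)%:E)%E.
    have itf := trig_closure_integrable m tf.
    have itg := trig_closure_integrable m tg.
    by rewrite integralD//= ?integralZl//; exact: integrableZl.
  by rewrite !E IHf IHg.
- have E (m : probability (n.-tuple R) R) :
      (\int[m]_x (f_ k x)%:E @[k --> \oo] --> \int[m]_x (f x)%:E)%E.
    have [|||||_ _ //] := @dominated_convergence _ _ R m setT measurableT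
        (fun k x => (f_ k x)%:E) (fun x => (f x)%:E) (cst B%:E).
    + move=> k; apply/measurable_EFinP; exact: trig_closure_measurable.
    + apply/measurable_EFinP; apply: (measurable_fun_cvg _ (fun x _ => fc x)).
      by move=> k; exact: trig_closure_measurable.
    + apply: aeW => x _; apply/fine_cvgP; split; [exact: nearW|exact: fc].
    + by apply: finite_measure_integrable_cst.
    + by apply: aeW => x k _; rewrite lee_fin.
  have := E mu; under eq_fun do rewrite IH.
  by move=> /cvg_lim <-//; move: (E nu) => /cvg_lim <-.
Qed.

Lemma eq_measure_of_cos_integrals A : measurable A -> mu A = nu A.
Proof.
move=> mA; have := trig_closure_integral (trig_closure_indic mA).
by rewrite !integral_indic// !setIT.
Qed.

End uniqueness.

(** * Centred Gaussian laws are determined by their variance *)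

Section normal_integral.
Context {R : realType}.
Local Notation leb := (@lebesgue_measure R).

Lemma normal_pdf_affine (m s y : R) : 0 < s ->
  normal_pdf m s (s * y + m) * s = normal_pdf 0 1 y.
Proof.
move=> s0; rewrite !normal_pdfE ?oner_neq0 ?gt_eqF//.
rewrite /normal_pdf/normal_peak /normal_fun.
rewrite addrK subr0 !exprMn expr1n mul1r mulrAC; congr (_ * expR _).
  rewrite -mulrnAr sqrtrM ?sqr_ge0// sqrtr_sqr gtr0_norm// invfM.
  by rewrite mulrAC mulVf ?gt_eqF// mul1r.
by field; rewrite gt_eqF.
Qed.

Lemma normal_pdf01N (y : R) : normal_pdf 0 1 (- y) = normal_pdf 0 1 y :> R.
Proof. by rewrite !normal_pdfE ?oner_neq0// /normal_fun !subr0 sqrrN. Qed.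

(** The Radon-Nikodym derivative of [normal_prob] agrees almost everywhere with [normal_pdf], since
    both have the same integral over every measurable set. *)
Lemma integral_normal_prob (m s : R) (f : R -> \bar R) :
  (normal_prob m s).-integrable setT f ->
  (\int[normal_prob m s]_x f x = \int[leb]_x (f x * (normal_pdf m s x)%:E))%E.
Proof.
move=> intf.
rewrite -(Radon_Nikodym_change_of_variables (normal_prob_dominates m s))//=.
have mf := measurable_int _ intf.
apply: ae_eq_integral => //.
- apply: emeasurable_funM => //; apply: (measurable_int leb).
  by apply: Radon_Nikodym_integrable; exact: normal_prob_dominates.
- apply: emeasurable_funM => //=; apply/measurable_EFinP.
  exact: measurable_normal_pdf.
- apply: ae_eqe_mul2l => /=.
  rewrite Radon_NikodymE//=; first exact: normal_prob_dominates.
  move=> dom; case: cid => /= h [h1 h2 h3].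
  apply: integral_ae_eq => //=.
  + by apply/measurable_EFinP; exact: measurable_normal_pdf.
  + by move=> E _ mE; rewrite -h3.
Qed.

Lemma ge0_integral_normal_affine (m s : R) (G : R -> R) : 0 < s ->
  continuous G -> (forall x, 0 <= G x) ->
  (\int[leb]_x (G x * normal_pdf m s x)%:E =
   \int[leb]_y (G (s * y + m) * normal_pdf 0 1 y)%:E)%E.
Proof.
move=> s0 cG G0.
(* Written as a translation followed by a positive scaling, so that its limits at both infinities
   follow from those of the two factors. *)
pose F (y : R) := (y + m / s) * s.
have FE y : F y = s * y + m by rewrite /F; field; rewrite gt_eqF.
have dF (x : R) : is_derive x (1 : R) F s.
  rewrite /F; apply: is_derive_eq.
  by rewrite addr0 scaler0 add0r /GRing.scale/= mulr1.
have F'E : F^`()%classic = cst s.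
  by apply/funext => x; rewrite derive1E derive_val.
rewrite (@increasing_ge0_integration_by_substitutionT R F).
- by apply: eq_integral => y _; rewrite F'E !fctE -mulrA FE normal_pdf_affine.
- by move=> x y xy; rewrite !FE ltrD2r ltr_pM2l.
- by rewrite F'E => x; exact: cvg_cst.
- by rewrite F'E; exact: is_cvg_cst.
- by rewrite F'E; exact: is_cvg_cst.
- by move=> x; exact: ex_derive.
- by apply/(gt0_cvgMlNy s0); exact: cvg_addrr_Ny.
- by apply/(gt0_cvgMly s0); exact: cvg_addrr.
- move=> x; apply: cvgM; first exact: cG.
  by apply: continuous_normal_pdf; rewrite gt_eqF.
- by move=> x; rewrite mulr_ge0// normal_pdf_ge0.
Qed.

(** Splitting at 0 and reflecting the negative half gives the half-line integrals of [g x] and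
    [g (- x)], a sum that is symmetric under reflection of [g]. *)
Lemma ge0_integral_opp (f : R -> R) : continuous f -> (forall x, 0 <= f x) ->
  (\int[leb]_x (f (- x))%:E = \int[leb]_x (f x)%:E)%E.
Proof.
have H (g : R -> R) : continuous g -> (forall x, 0 <= g x) ->
    (\int[leb]_x (g x)%:E = \int[leb]_(x in `[0%R, +oo[) (g x)%:E +
                            \int[leb]_(x in `[0%R, +oo[) (g (- x))%:E)%E.
  move=> cg g0; have mg := continuous_measurable_fun cg.
  rewrite -(setUv `[0%R, +oo[%classic) ge0_integral_setU//=.
  - congr +%E; rewrite setCitvr.
    rewrite integral_itv_bndo_bndc; last first.
      exact/measurable_EFinP/measurable_funTS.
    rewrite -{1}oppr0 ge0_integration_by_substitutionNy//.
    exact: continuous_subspaceT.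
  - exact: measurableC.
  - by apply/measurable_EFinP; rewrite setUv.
  - by move=> x _; rewrite lee_fin.
  - exact/disj_setPCl.
move=> cf f0; rewrite (H f)// (H (fun x => f (- x)))//.
  by under [X in (_ + X)%E]eq_integral do rewrite opprK; rewrite addeC.
move=> x; apply: (cvg_comp (@GRing.opp R) f); last exact: cf.
exact: oppr_continuous.
Qed.

(** The integrand is positive on [[1, 2]], which is not a null set. This allows the scale of a
    centred normal law to be recovered from its variance. *)
Lemma normal_second_moment_neq0 :
  (\int[leb]_y (y ^+ 2 * normal_pdf 0 1 y)%:E != 0)%E.
Proof.
set f := fun y : R => (y ^+ 2 * normal_pdf 0 1 y)%:E.
have mf : measurable_fun setT f.
  apply/measurable_EFinP; apply: measurable_funM; first exact: exprn_measurable.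
  exact: measurable_normal_pdf.
apply/eqP => f0.
have : (\int[leb]_y `|f y| = 0)%E.
  rewrite -f0; apply: eq_integral => y _; rewrite gee0_abs// lee_fin.
  by rewrite mulr_ge0 ?sqr_ge0 ?normal_pdf_ge0.
move=> /(ae_eq_integral_abs leb measurableT mf) [N [mN N0 sN]].
have : (leb `[1%R, 2%R]%classic <= leb N)%E.
  apply: le_measure; rewrite ?inE// => y; rewrite /= in_itv/= => /andP[y1 _].
  apply: sN => /= /(_ I) [] /eqP; apply/negP.
  rewrite mulf_neq0// ?expf_neq0 ?gt_eqF//; first exact: lt_le_trans y1.
  rewrite normal_pdfE ?oner_neq0// mulr_gt0 ?expR_gt0//.
  by rewrite normal_peak_gt0// oner_neq0.
rewrite [leb N]N0 lebesgue_measure_itv/= lte_fin ltr1n -EFinB lee_fin; lra.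
Qed.

End normal_integral.

(** * Moments of a Gaussian variable and the identification of its law *)

Section gaussian_law.
Context {d : measure_display} {T : measurableType d} {R : realType}.
Variable P : probability T R.
Local Notation leb := (@lebesgue_measure R).
Implicit Types (X Y : {RV P >-> R}) (f : R -> R).

(* [normal_prob] is a measure on [measurableTypeR R], which has the Borel sets
   of [R] but is a different [measurableType]; hence the retyping of [X]. *)
Lemma ge0_integral_law X (nu : {measure set (measurableTypeR R) -> \bar R}) f :
  (forall A : set R, measurable A -> distribution P X A = nu A) ->
  measurable_fun setT f -> (forall x, 0 <= f x) ->
  (\int[P]_w (f (X w))%:E = \int[nu]_x (f x)%:E)%E.
Proof.
move=> lawX mf f0.
have mX : @measurable_fun _ _ T (measurableTypeR R) setT X.
  by move=> mT B mB; exact: (measurable_funP X).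
pose Y : {mfun T >-> measurableTypeR R} := 
  @mfun_Sub _ _ T (measurableTypeR R) X (mem_set mX).
transitivity (\int[distribution P Y]_x (f x)%:E)%E.
  rewrite (@ge0_integral_distribution _ _ _ _ _ _ Y (EFin \o f))//.
  exact/measurable_EFinP.
by apply: eq_measure_integral => A mA _; exact: lawX.
Qed.

Lemma integral_normal_law X (m s : R) f : 0 < s ->
  (forall A : set R, measurable A -> distribution P X A = normal_prob m s A) ->
  continuous f -> (forall x, 0 <= f x) ->
  P.-integrable setT (fun w => (f (X w))%:E) ->
  (\int[P]_w (f (X w))%:E =
   \int[leb]_y (f (s * y + m) * normal_pdf 0 1 y)%:E)%E.
Proof.
move=> s0 lawX cf f0 /integrableP[_ iX].
have mf := continuous_measurable_fun cf.
have E := ge0_integral_law (nu := normal_prob m s) lawX mf f0.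
rewrite -ge0_integral_normal_affine// E integral_normal_prob//.
apply/integrableP; split; first exact/measurable_EFinP.
under eq_integral do rewrite gee0_abs ?lee_fin//.
rewrite -E; apply: le_lt_trans iX.
by under [leRHS]eq_integral do rewrite gee0_abs ?lee_fin//.
Qed.

(** Integrability of the processes is read off from the covariance being a real number. *)
Lemma integrable_sqr X (v : R) : ('E_P[X \* X] = v%:E)%E ->
  P.-integrable setT (fun w => (X w ^+ 2)%:E).
Proof.
move=> EX2; apply/integrableP; split.
  by apply/measurable_EFinP; apply: measurable_funX; exact: measurable_funP.
under eq_integral do rewrite gee0_abs ?lee_fin ?sqr_ge0// expr2.
by move: EX2; rewrite unlock => ->; rewrite ltry.
Qed.

Lemma integrable_of_sqr X :
  P.-integrable setT (fun w => (X w ^+ 2)%:E) ->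
  P.-integrable setT (fun w => (X w)%:E).
Proof.
move=> iX2; apply: (@le_integrable _ _ _ P setT measurableT _
  (fun w => (1 + X w ^+ 2)%:E)).
- by apply/measurable_EFinP; exact: measurable_funP.
- move=> w _; rewrite lee_fin [leRHS]ger0_norm ?addr_ge0 ?sqr_ge0//.
  rewrite -[X w ^+ 2]real_normK ?num_real//.
  by have := sqr_ge0 (`|X w| - 1); nra.
- under eq_fun do rewrite EFinD; apply: integrableD => //.
  exact: finite_measure_integrable_cst.
Qed.

Lemma integrable_abs_sub X (m : R) : P.-integrable setT (fun w => (X w)%:E) ->
  P.-integrable setT (fun w => (X w - m)%:E) /\
  P.-integrable setT (fun w => `|X w - m|%:E).
Proof.
move=> iX.
have iXm : P.-integrable setT (fun w => (X w - m)%:E).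
  under eq_fun do rewrite EFinB; apply: integrableB => //.
  exact: finite_measure_integrable_cst.
by split=> //; exact: integrable_abse iXm.
Qed.

(* Both integrands are nonnegative, so the hypothesis can be checked by
   transporting integrals of nonnegative functions. *)
Lemma expectation_of_balance X (m : R) :
  P.-integrable setT (fun w => (X w)%:E) ->
  (\int[P]_w (`|X w - m| + (X w - m))%:E =
   \int[P]_w (`|X w - m| - (X w - m))%:E)%E ->
  ('E_P[X] = m%:E)%E.
Proof.
move=> iX; have [iXm iaXm] := integrable_abs_sub m iX.
have -> : (\int[P]_w (`|X w - m| + (X w - m))%:E =
    \int[P]_w `|X w - m|%:E + \int[P]_w (X w - m)%:E)%E.
  by under eq_integral do rewrite EFinD; rewrite integralD.
have -> : (\int[P]_w (`|X w - m| - (X w - m))%:E =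
    \int[P]_w `|X w - m|%:E - \int[P]_w (X w - m)%:E)%E.
  by under eq_integral do rewrite EFinB; rewrite integralB.
have -> : (\int[P]_w (X w - m)%:E = 'E_P[X] - m%:E)%E.
  under eq_integral do rewrite EFinB.
  rewrite integralB//=; last exact: finite_measure_integrable_cst.
  by rewrite integral_cst//= probability_setT mule1 unlock.
have := integrable_fin_num measurableT iaXm.
have : 'E_P[X]%E \is a fin_num by rewrite unlock; exact: integrable_fin_num.
case: 'E_P[X]%E => // u _; case: (integral _ _ _) => // v _.
by rewrite -!EFinB -!EFinD => -[h]; congr EFin; lra.
Qed.

(** The parameters hidden in [gaussian_rv] are pinned by the moments: the mean forces [m = 0], and
    [v] is [s ^+ 2] times the second moment of the standard normal law, kept as an unevaluated
    integral. *)
Lemma gaussian_rv_centred_law X (v : R) : gaussian_rv X ->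
  ('E_P[X] = 0)%E -> ('E_P[X \* X] = v%:E)%E ->
  (v = 0 /\ forall A : set R, measurable A ->
    distribution P X A = \d_(0 : R) A) \/
  (exists s : R, [/\ 0 < s,
    (v%:E = (s ^+ 2)%:E * \int[leb]_y (y ^+ 2 * normal_pdf 0 1 y)%:E)%E &
    forall A : set R, measurable A -> distribution P X A = normal_prob 0 s A]).
Proof.
move=> gX EX EX2.
have iX2 := integrable_sqr EX2.
have iX := integrable_of_sqr iX2.
have EX2' : (\int[P]_w (X w ^+ 2)%:E = v%:E)%E.
  by rewrite -EX2 unlock; apply: eq_integral => w _; rewrite expr2.
(* Twice the positive and the negative part of [x - m]: continuous and nonnegative, as the transport
   lemmas require. *)
pose Gp (m x : R) : R := `|x - m| + (x - m).
pose Gm (m x : R) : R := `|x - m| - (x - m).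
have Gp0 m x : 0 <= Gp m x.
  by rewrite /Gp -lerBlDr sub0r -normrN ler_norm.
have Gm0 m x : 0 <= Gm m x by rewrite /Gm subr_ge0 ler_norm.
have csub m : continuous (fun x : R => x - m).
  by move=> x; apply: cvgB; [exact: cvg_id|exact: cvg_cst].
have cnsub m : continuous (fun x : R => `|x - m|).
  by move=> x; apply: cvg_norm; exact: csub.
have cGp m : continuous (Gp m).
  by move=> x; apply: cvgD; [exact: cnsub|exact: csub].
have cGm m : continuous (Gm m).
  by move=> x; apply: cvgB; [exact: cnsub|exact: csub].
have csqr : continuous (fun x : R => x ^+ 2) by exact: exprn_continuous.
case: gX => [[m lawX]|[m [s [s0 lawX]]]].
- left.
  have E f : measurable_fun setT f -> (forall x, 0 <= f x) ->
      (\int[P]_w (f (X w))%:E = (f m)%:E)%E.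
    move=> mf f0.
    rewrite (ge0_integral_law (nu := @dirac _ (measurableTypeR R) m R) lawX)//.
    by rewrite integral_dirac//= ?diracT ?mul1e//; exact/measurable_EFinP.
  have m0 : m = 0.
    suff : ('E_P[X] = m%:E)%E by rewrite EX => -[].
    apply: expectation_of_balance => //.
    rewrite -/(Gp m _).
    rewrite (E (Gp m)) ?(E (Gm m))//; try exact: continuous_measurable_fun.
    by rewrite /Gp /Gm subrr normr0 subrr addr0.
  split; last by rewrite -m0.
  apply: EFin_inj; rewrite -EX2' (E (fun x => x ^+ 2)) ?m0 ?expr0n//.
  by move=> x; exact: sqr_ge0.
- right; exists s.
  have [iXm iaXm] := integrable_abs_sub m iX.
  have m0 : m = 0.
    suff : ('E_P[X] = m%:E)%E by rewrite EX => -[].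
    apply: expectation_of_balance => //.
    rewrite (@integral_normal_law X m s (Gp m))//; last first.
      by rewrite /Gp; under eq_fun do rewrite EFinD; exact: integrableD.
    rewrite (@integral_normal_law X m s (Gm m))//; last first.
      by rewrite /Gm; under eq_fun do rewrite EFinB; exact: integrableB.
    (* The standard normal density is even. *)
    rewrite -ge0_integral_opp; last 2 first.
    + move=> x; apply: cvgM; last exact/continuous_normal_pdf/oner_neq0.
      apply: (cvg_comp (fun y => s * y + m) (Gp m)); last exact: cGp.
      apply: cvgD; last exact: cvg_cst.
      by apply: cvgM; [exact: cvg_cst|exact: cvg_id].
    + by move=> x; rewrite mulr_ge0 ?normal_pdf_ge0.
    apply: eq_integral => y _; rewrite normal_pdf01N /Gp /Gm !addrK.
    by rewrite mulrN normrN.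
  split=> //; last by rewrite -m0.
  rewrite -EX2' (@integral_normal_law X m s (fun x => x ^+ 2))//; last first.
    by move=> x; exact: sqr_ge0.
  rewrite -ge0_integralZl//; last 3 first.
  + apply/measurable_EFinP; apply: measurable_funM.
      exact: exprn_measurable.
    exact: measurable_normal_pdf.
  + by move=> y _; rewrite lee_fin mulr_ge0 ?sqr_ge0 ?normal_pdf_ge0.
  + by rewrite lee_fin sqr_ge0.
  by apply: eq_integral => y _; rewrite m0 addr0 exprMn -EFinM -!mulrA.
Qed.

Lemma gaussian_rv_law_eq X Y (v : R) : gaussian_rv X -> gaussian_rv Y ->
  ('E_P[X] = 0)%E -> ('E_P[Y] = 0)%E ->
  ('E_P[X \* X] = v%:E)%E -> ('E_P[Y \* Y] = v%:E)%E ->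
  forall A : set R, measurable A -> distribution P X A = distribution P Y A.
Proof.
move=> gX gY EX EY EX2 EY2 A mA.
have k0 := @normal_second_moment_neq0 R.
have [[v0 lX]|[s [s0 vs lX]]] := gaussian_rv_centred_law gX EX EX2;
have [[w0 lY]|[u [u0 vu lY]]] := gaussian_rv_centred_law gY EY EY2.
- by rewrite lX// lY.
(* A point mass has variance 0, whereas a normal law with positive scale does not. *)
- move: vu; rewrite v0 => /esym/eqP.
  by rewrite mule_eq0 eqe expf_eq0/= gt_eqF//= (negbTE k0).
- move: vs; rewrite w0 => /esym/eqP.
  by rewrite mule_eq0 eqe expf_eq0/= gt_eqF//= (negbTE k0).
- rewrite lX// lY//; suff -> : s = u by [].
  have s20 : (0 < (s ^+ 2)%:E)%E by rewrite lte_fin exprn_gt0.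
  (* The common integral is finite, as its product with [s ^+ 2] is the real [v]; it then cancels
     and leaves [s ^+ 2 = u ^+ 2]. *)
  move: vs vu k0; case: (integral _ _ _) => [k| |].
  + move=> -> [] + k0 => /mulIf h.
    by apply/eqP; rewrite -(eqrXn2 (n := 2)) ?ltW//; apply/eqP/h.
  + by rewrite gt0_muley.
  + by rewrite gt0_muleNy.
Qed.

End gaussian_law.

(** * Stationarity *)

Section stationarity.
Context {d : measure_display} {T : measurableType d} {R : realType}.
Variable P : probability T R.

Lemma integrable_mul_of_sqr (X Y : {RV P >-> R}) :
  P.-integrable setT (fun w => (X w ^+ 2)%:E) ->
  P.-integrable setT (fun w => (Y w ^+ 2)%:E) ->
  P.-integrable setT (fun w => (X w * Y w)%:E).
Proof.
move=> iX iY; apply: (@le_integrable _ _ _ P setT measurableT _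
  (fun w => (X w ^+ 2 + Y w ^+ 2)%:E)).
- by apply/measurable_EFinP; apply: measurable_funM; exact: measurable_funP.
- move=> w _; rewrite lee_fin [leRHS]ger0_norm; last first.
    by rewrite addr_ge0// sqr_ge0.
  by rewrite ler_norml; apply/andP; split; nra.
- by under eq_fun do rewrite EFinD; exact: integrableD.
Qed.

Section linear_combinations.
Context {I : Type} (X : I -> {RV P >-> R}) (r : I -> I -> R).
Hypothesis covX : forall s t, ('E_P[X s \* X t] = (r s t)%:E)%E.

Let iX2 t : P.-integrable setT (fun w => (X t w ^+ 2)%:E).
Proof. exact: integrable_sqr (covX t t). Qed.

Lemma linear_comb_apply n (t : 'I_n -> I) (a : 'I_n -> R) w :
  (\sum_(i < n) a i *: X (t i)) w = \sum_(i < n) a i * X (t i) w.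
Proof. by rewrite mfun_sum. Qed.

Lemma expectation_linear_comb n (t : 'I_n -> I) (a : 'I_n -> R) :
  centred X -> ('E_P[(\sum_(i < n) a i *: X (t i) : {RV P >-> R})] = 0)%E.
Proof.
move=> cX; rewrite unlock.
have iX s : P.-integrable setT (fun w => (X s w)%:E).
  exact: integrable_of_sqr.
under eq_integral do rewrite linear_comb_apply -sumEFin.
rewrite integral_sum//; last first.
  by move=> i; under eq_fun do rewrite EFinM; exact: integrableZl.
rewrite big1// => i _; under eq_integral do rewrite EFinM.
by rewrite integralZl//; have := cX (t i); rewrite unlock => ->; rewrite mule0.
Qed.

(** The times enter only through [r], which is how shift invariance of the covariance reaches the
    laws. *)
Lemma second_moment_linear_comb n (t : 'I_n -> I) (a : 'I_n -> R) :
  let Y : {RV P >-> R} := \sum_(i < n) a i *: X (t i) in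
  ('E_P[Y \* Y] =
   (\sum_(i < n) \sum_(j < n) a i * a j * r (t i) (t j))%:E)%E.
Proof.
move=> Y; rewrite unlock.
have iXX s u k : P.-integrable setT (fun w => (k * (X s w * X u w))%:E).
  under eq_fun do rewrite EFinM; apply: integrableZl => //.
  exact: integrable_mul_of_sqr.
have E w : (((Y \* Y) w)%:E = \sum_(i < n) \sum_(j < n)
    (a i * a j * (X (t i) w * X (t j) w))%:E)%E.
  rewrite /= /Y linear_comb_apply big_distrl/= -sumEFin.
  apply: eq_bigr => i _; rewrite sumEFin big_distrr/=; congr EFin.
  by apply: eq_bigr => j _; ring.
under eq_integral do rewrite E.
rewrite integral_sum//; last by move=> i; exact: integrable_sum.
rewrite -sumEFin; apply: eq_bigr => i _.
rewrite integral_sum// -sumEFin; apply: eq_bigr => j _.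
under eq_integral do rewrite EFinM.
rewrite integralZl//; last exact: integrable_mul_of_sqr.
by have := covX (t i) (t j); rewrite unlock => ->.
Qed.

End linear_combinations.

(** Cramér-Wold reduction: both sides are the same expectation under [P], so joint laws can be
    compared through scalar linear combinations. *)
Lemma integral_cos_fd_vector {I : Type} (X : I -> {RV P >-> R}) n
    (t : 'I_n -> I) (a : 'I_n -> R) (c : R) :
  (\int[distribution P (fd_vector X t)]_x
      (cos (\sum_(i < n) a i * tnth x i + c))%:E =
   \int[distribution P (\sum_(i < n) a i *: X (t i) : {RV P >-> R})%R]_y
      (cos (y + c))%:E)%E.
Proof.
have mcos : measurable_fun setT (fun y : R => cos (y + c)).
  apply: continuous_measurable_fun => y.
  apply: (cvg_comp (fun y => y + c) (@cos R)); last exact: continuous_cos.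
  by apply: cvgD; [exact: cvg_id|exact: cvg_cst].
have icos (Z : {RV P >-> R}) : P.-integrable setT (fun w => (cos (Z w + c))%:E).
  apply: measurable_bounded_integrable => //.
  - by rewrite (le_lt_trans (probability_le1 _ _)) ?ltry.
  - exact: (measurableT_comp mcos (@measurable_funP _ _ _ _ setT Z)).
  - by exists 1; split=> // x x1 w _; rewrite /= (le_trans (cos_max _))// ltW.
pose Y : {RV P >-> R} := \sum_(i < n) a i *: X (t i).
have E w : \sum_(i < n) a i * tnth (fd_vector X t w) i + c = Y w + c.
  rewrite /Y linear_comb_apply; congr (_ + _).
  by apply: eq_bigr => i _; rewrite tnth_mktuple.
rewrite integral_distribution; last 2 first.
- apply/measurable_EFinP; exact: trig_closure_measurable (trig_cos a c).
- by apply: eq_integrable (icos Y) => // w _; rewrite /= E.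
rewrite integral_distribution; last 2 first.
- exact/measurable_EFinP.
- exact: icos.
by apply: eq_integral => w _; rewrite /= E.
Qed.

Lemma gaussian_stationary (X : R -> {RV P >-> R}) (r : R -> R -> R) :
  gaussian_process X -> centred X ->
  (forall s t, ('E_P[X s \* X t] = (r s t)%:E)%E) ->
  (forall s t h, r (s + h) (t + h) = r s t) -> stationary X.
Proof.
move=> gX cX covX shift n t h A mA.
apply: (eq_measure_of_cos_integrals
  (mu := distribution P (fd_vector X (fun i => t i + h)))
  (nu := distribution P (fd_vector X t))) => // a c.
rewrite !integral_cos_fd_vector.
(* It remains to compare the laws of one linear combination at the shifted and at the original
   times: both are centred Gaussian, with equal variances by [shift]. *)
apply: eq_measure_integral => B mB _.
apply: gaussian_rv_law_eq mB; [exact: gX|exact: gX| | | |].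
- exact: expectation_linear_comb covX _ _ _ cX.
- exact: expectation_linear_comb covX _ _ _ cX.
- exact: second_moment_linear_comb covX _ _ _.
- rewrite (second_moment_linear_comb covX).
  by under eq_bigr do under eq_bigr do rewrite -(shift _ _ h).
Qed.

End stationarity.

(** * The Lamperti transform of sub-fractional Brownian motion *)

Section lamperti.
Context {d : measure_display} {T : measurableType d} {R : realType}.
Variables (P : probability T R) (alpha H : R) (S : {nonneg R} -> {RV P >-> R}).

(** The exponential factors are absorbed into the coefficients of the linear combination. *)
Lemma lamperti_gaussian :
  gaussian_process S -> gaussian_process (lamperti alpha H S).
Proof.
move=> gS n t a; rewrite /lamperti.
under eq_bigr do rewrite scalerA.
exact: gS.
Qed.

Definition lamperti_cov (s t : R) : R :=
  expR (- (alpha * H * s)) * expR (- (alpha * H * t)) *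
  (expR (alpha * s) `^ (2 * H) + expR (alpha * t) `^ (2 * H) -
   2^-1 * ((expR (alpha * s) + expR (alpha * t)) `^ (2 * H) +
           `|expR (alpha * t) - expR (alpha * s)| `^ (2 * H))).

Lemma lamperti_cov_shift (s t h : R) :
  lamperti_cov (s + h) (t + h) = lamperti_cov s t.
Proof.
rewrite /lamperti_cov.
have E u : expR (alpha * (u + h)) = expR (alpha * h) * expR (alpha * u).
  by rewrite -expRD; congr expR; ring.
have F u : expR (- (alpha * H * (u + h))) =
    expR (- (alpha * H * h)) * expR (- (alpha * H * u)).
  by rewrite -expRD; congr expR; ring.
rewrite !E !F -mulrDr -mulrBr normrM (ger0_norm (expR_ge0 _)).
rewrite !powRM ?expR_ge0 ?addr_ge0 ?expR_ge0//.
have K : expR (- (alpha * H * h)) * expR (- (alpha * H * h)) *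
    expR (alpha * h) `^ (2 * H) = 1.
  rewrite -expRM -!expRD (_ : _ + _ + _ = 0) ?expR0//; ring.
set k := _ `^ (2 * H) in K *; set e := expR (- (alpha * H * h)) in K *.
transitivity (e * e * k * (expR (- (alpha * H * s)) * expR (- (alpha * H * t)) *
  (expR (alpha * s) `^ (2 * H) + expR (alpha * t) `^ (2 * H) -
   2^-1 * ((expR (alpha * s) + expR (alpha * t)) `^ (2 * H) +
           `|expR (alpha * t) - expR (alpha * s)| `^ (2 * H))))).
  by ring.
by rewrite K mul1r.
Qed.

Hypothesis hS : sub_fBm H S.

Lemma lamperti_covariance (s t : R) :
  ('E_P[lamperti alpha H S s \* lamperti alpha H S t] =
   (lamperti_cov s t)%:E)%E.
Proof.
have iSS u := integrable_sqr (sub_fBm_covariance hS u u).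
rewrite unlock /lamperti_cov EFinM.
have := sub_fBm_covariance hS (NngNum (expR_ge0 (alpha * s)))
  (NngNum (expR_ge0 (alpha * t))); rewrite unlock /= => <-.
rewrite -integralZl//; last exact: integrable_mul_of_sqr.
by apply: eq_integral => w _; rewrite -EFinM /lamperti /= mulrACA.
Qed.

Lemma lamperti_centred : centred (lamperti alpha H S).
Proof.
move=> t; rewrite unlock /lamperti /=.
set u := NngNum _.
have iS := integrable_of_sqr (integrable_sqr (sub_fBm_covariance hS u u)).
under eq_integral do rewrite EFinM.
rewrite integralZl//; have := sub_fBm_centred hS u; rewrite unlock => ->.
by rewrite mule0.
Qed.

End lamperti.

Theorem theorem2p5 (d : measure_display) (T : measurableType d) (R : realType)
  (P : probability T R) (H alpha : R) (hH0 : 0 < H) (hH1 : H < 1)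
  (halpha : 0 < alpha) (S : {nonneg R} -> {RV P >-> R}) (hS : sub_fBm H S) :
  centred (lamperti alpha H S) /\
  stationary (lamperti alpha H S) /\
  gaussian_process (lamperti alpha H S).
Proof.
have gL := lamperti_gaussian alpha H (sub_fBm_gaussian hS).
have cL := @lamperti_centred _ _ _ P alpha H S hS.
split=> //; split=> //.
exact: gaussian_stationary gL cL (lamperti_covariance alpha hS)
  (@lamperti_cov_shift _ alpha H).
Qed.
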